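(* For every finite lattice $L$ there exists a finite simple undirected graph $G$ of maximum degree at most $3$ such that $\mathrm{End}(G)\cong (L,\wedge)$ as monoids.
   Context: A lattice $L$ is regarded as the commutative idempotent monoid $(L,\wedge)$ (its identity is the maximum $\hat 1$). For a graph $G$, an endomorphism is a map $\varphi:V(G)\to V(G)$ such that $\{u,v\}\in E(G)$ implies $\{\varphi(u),\varphi(v)\}\in E(G)$; $\mathrm{End}(G)$ is the monoid of all endomorphisms under composition. *)

(* Defs.v *)
From HB Require Import structures.
From mathcomp Require Import all_boot all_order.

Set Implicit Arguments.
Unset Strict Implicit.
Unset Printing Implicit Defensive.

Import Order.LTheory.

Record sgraph := SGraph {
  vertex :> finType;
  adj : rel vertex;
  adj_sym : symmetric adj;
  adj_irr : irreflexive adj }.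

Definition degree (G : sgraph) (u : G) : nat := #|[set v : G | adj u v]|.

Definition max_degree (G : sgraph) : nat := \max_(u : G) degree u.

Section Endomorphisms.

Variable G : sgraph.

Definition is_endo (f : {ffun G -> G}) : bool :=
  [forall u, forall v, adj u v ==> adj (f u) (f v)].

Record End := MkEnd { endo_fun :> {ffun G -> G}; endoP : is_endo endo_fun }.

HB.instance Definition _ := [isSub for endo_fun].
HB.instance Definition _ := [Finite of End by <:].

Fact endo_id_subproof : is_endo [ffun u => u].
Proof. by apply/forallP=> u; apply/forallP=> v; rewrite !ffunE implybb. Qed.

Fact endo_comp_subproof (f g : End) : is_endo [ffun u => f (g u)].
Proof.
apply/forallP=> u; apply/forallP=> v; rewrite !ffunE; apply/implyP=> uv.
have /forallP/(_ u)/forallP/(_ v)/implyP/(_ uv) guv := endoP g.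
exact: (implyP (forallP (forallP (endoP f) (g u)) (g v))).
Qed.

Definition endo_id : End := MkEnd endo_id_subproof.
Definition endo_comp (f g : End) : End := MkEnd (endo_comp_subproof f g).

Fact endo_compA : associative endo_comp.
Proof. by move=> f g h; apply/val_inj/ffunP=> u; rewrite !ffunE. Qed.

Fact endo_comp_idl : left_id endo_id endo_comp.
Proof. by move=> f; apply/val_inj/ffunP=> u; rewrite !ffunE. Qed.

Fact endo_comp_idr : right_id endo_id endo_comp.
Proof. by move=> f; apply/val_inj/ffunP=> u; rewrite !ffunE. Qed.

HB.instance Definition _ :=
  isMonoid.Build End endo_compA endo_comp_idl endo_comp_idr.

End Endomorphisms.

(* Alias of L carrying the monoid structure (meet, \top), so that L itself
   gets no multiplicative structure. *)
Definition meet_monoid (d : Order.disp_t) (L : tMeetSemilatticeType d) : Type :=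
  L.

Section MeetMonoid.

Variables (d : Order.disp_t) (L : tMeetSemilatticeType d).

HB.instance Definition _ := Choice.on (meet_monoid L).
HB.instance Definition _ := isMonoid.Build (meet_monoid L)
  (@meetA d L) (@meet1x d L) (@meetx1 d L).

End MeetMonoid.

Definition monoid_isomorphic (M N : monoidType) : Prop :=
  exists2 f : M -> N, monoid_morphism f & bijective f.

(* Main.v *)
(* Let p range over L.  A map g : L -> L is a translation x /\ _ as soon as each
   relation "p <= w" is respected up to replacing "true" by "false" uniformly:
   if p <= g w implies p <= w, and if for p <= w the truth value of p <= g w does
   not depend on w, then g w = g 1 /\ w.  To express this by a partial unary
   algebra with bounded fibres, list L along a linear extension and, for each p,
   collapse L onto {0, p} (w goes to p if p <= w and to 0 otherwise) in steps
   which identify one new element at a time.  Each step is a quotient of the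
   L-set L with fibres of size at most 2.  These chains are hung in a comb on a
   row of copies of L, and the final 0 is marked by a loop; the endomorphisms of
   the resulting algebra with two partial operations are exactly the actions of
   the elements of L.

   Such an algebra becomes a subcubic graph by replacing every element e with a
   copy of a rigid graph K on 13 vertices; e has moreover a hub vertex, adjacent
   to one port of its own copy of K and to a port of the copy of K of each
   element sent to e by one of the operations (hence to at most three vertices).
   Identifying all the copies of K and all the hubs maps this graph to a 14-vertex
   graph H = K + hub such that the inclusion is the only homomorphism K -> H.  So
   an endomorphism maps copies of K identically onto copies of K, and then hubs
   to hubs, as two distinct ports have no other common neighbour in H. *)

Require Import Defs.
From HB Require Import structures.
From mathcomp Require Import all_boot all_order.

Set Implicit Arguments.
Unset Strict Implicit.
Unset Printing Implicit Defensive.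

Import Order.TTheory.

(** * The rigid gadget *)

(* The adjacency lists of H: vertex 13 is the hub, and its neighbours 6, 11 and
   12 are the ports.  The graph was found by a random search; the vertices are
   numbered so as to keep the enumeration of partial homomorphisms small. *)
Definition gadget_nbrs : seq (seq nat) :=
  [:: [:: 1; 2; 7]; [:: 0; 3; 6]; [:: 0; 4; 5]; [:: 1; 4; 5]; [:: 2; 3; 11];
      [:: 2; 3; 12]; [:: 1; 8; 13]; [:: 0; 8; 10]; [:: 6; 7; 9];
      [:: 8; 10; 11]; [:: 7; 9; 12]; [:: 4; 9; 13]; [:: 5; 10; 13];
      [:: 6; 11; 12]].

Definition gadj (x y : nat) : bool := y \in nth [::] gadget_nbrs x.

Lemma gadj_lt x y : gadj x y -> (x < 14) && (y < 14).
Proof.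
rewrite /gadj; case: (ltnP x 14) => [x14|x14 /=]; last by rewrite nth_default.
suff /allP/(_ _ (mem_nth [::] (x14 : x < size gadget_nbrs)))/allP H :
  all (all (gtn 14)) gadget_nbrs by move/H.
by [].
Qed.

Lemma gadget_all2 (P : nat -> nat -> bool) :
  all (fun x => all (P x) (iota 0 14)) (iota 0 14) ->
  forall x y, x < 14 -> y < 14 -> P x y.
Proof.
by move=> /allP H x y xn yn; apply: (allP (H x _)); rewrite mem_iota.
Qed.

Lemma gadj_sym : symmetric gadj.
Proof.
move=> x y; apply/idP/idP => g; have /andP[xn yn] := gadj_lt g; move: g;
  apply/implyP; first by apply: (@gadget_all2 (fun x y => gadj x y ==> gadj y x)).
by apply: (@gadget_all2 (fun x y => gadj y x ==> gadj x y)).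
Qed.

Lemma gadj_irr : irreflexive gadj.
Proof.
move=> x; apply/negP => g; have /andP[xn _] := gadj_lt g; move: g; apply/negP.
by apply: (@gadget_all2 (fun x _ => ~~ gadj x x) _ x x).
Qed.

(** Only edges to earlier vertices are tested, so that partial homomorphisms can be extended one
    vertex at a time. *)
Definition candidates (k : nat) (s : seq nat) : seq nat :=
  [seq x <- iota 0 14 | all (fun j => gadj (nth 0 s j) x)
                            [seq j <- nth [::] gadget_nbrs k | j < k]].

Fixpoint partial_homs (k : nat) : seq (seq nat) :=
  if k is k'.+1 then
    [seq rcons s x | s <- partial_homs k', x <- candidates k' s]
  else [:: [::]].

Lemma partial_homsP (f : nat -> nat) (k : nat) : k <= 13 ->
  (forall i, i < 13 -> f i < 14) ->
  (forall i j, i < 13 -> j < 13 -> gadj i j -> gadj (f i) (f j)) ->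
  mkseq f k \in partial_homs k.
Proof.
move=> + fn fadj; elim: k => // k IHk kn.
have {IHk} := IHk (ltnW kn); rewrite [mkseq f k.+1]mkseqS /= => fk.
apply/allpairsPdep; exists (mkseq f k), (f k); split=> //.
rewrite mem_filter mem_iota fn // !andbT.
apply/allP => j; rewrite mem_filter => /andP[jk kj].
by rewrite nth_mkseq // gadj_sym fadj // (ltn_trans jk).
Qed.

Lemma gadget_rigid (f : nat -> nat) :
  (forall i, i < 13 -> f i < 14) ->
  (forall i j, i < 13 -> j < 13 -> gadj i j -> gadj (f i) (f j)) ->
  forall i, i < 13 -> f i = i.
Proof.
move=> fn fadj i i13; have := partial_homsP (leqnn _) fn fadj.
have -> : partial_homs 13 = [:: iota 0 13] by vm_compute.
by rewrite inE => /eqP/(congr1 (nth 0 ^~ i)); rewrite nth_mkseq // nth_iota.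
Qed.

Lemma gadget_back_neighbour k : 0 < k < 13 -> exists2 j, j < k & gadj k j.
Proof.
move=> k13; have : all (fun k => has (gadj k) (iota 0 k)) (iota 1 12) by [].
move=> /allP/(_ k); rewrite mem_iota => /(_ k13)/hasP[j].
by rewrite mem_iota => jk kj; exists j.
Qed.

(** The other neighbours 1 and 8 of port 6 are adjacent to neither 11 nor 12. *)
Lemma gadget_ports_common x (b : bool) :
  gadj 6 x -> gadj (if b then 12 else 11) x -> x = 13.
Proof. by rewrite {1}/gadj !inE => /or3P[]/eqP-> //; case: b. Qed.

Lemma leq_card_seq (T : finType) (U : eqType) (A : {set T}) (f : T -> U)
    (r : seq U) :
  {in A &, injective f} -> {in A, forall x, f x \in r} -> #|A| <= size r.
Proof.
move=> finj fr; rewrite cardE -(size_map f); apply: uniq_leq_size.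
  by rewrite map_inj_in_uniq ?enum_uniq // => x y; rewrite !mem_enum; apply: finj.
by move=> _ /mapP[x + ->]; rewrite mem_enum; apply: fr.
Qed.

(** * Gadget replacement in a partial algebra *)

Section GadgetReplacement.

Variables (E : finType) (s : bool -> E -> option E).

Definition target (e : E) : bool := [exists q : bool * E, s q.1 q.2 == Some e].

(* Port 6 of the copy of e is attached to the hub of e; ports 11 and 12 are
   attached to the hubs of s false e and s true e, if these are defined. *)
Definition port_target (y : nat) (e : E) : option E :=
  if y == 6 then Some e else s (y == 12) e.

(* A hub with no preimage under s would have degree 1 and could be folded. *)
Definition gvertex : finType := {u : E * 'I_14 | (u.2 != 13 :> nat) || target u.1}.

Definition gvertex_adj (u v : gvertex) : bool :=
  let: (e, x) := val u in let: (e', y) := val v in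
  gadj x y && (if x == 13 :> nat then port_target y e' == Some e
               else if y == 13 :> nat then port_target x e == Some e'
               else e == e').

Fact gvertex_adj_sym : symmetric gvertex_adj.
Proof.
move=> u v; rewrite /gvertex_adj; case: (val u) (val v) => [e x] [e' y].
rewrite gadj_sym; have [->|_] := eqVneq (x : nat) 13;
  have [->|_] := eqVneq (y : nat) 13; rewrite ?gadj_irr //.
by rewrite eq_sym.
Qed.

Fact gvertex_adj_irr : irreflexive gvertex_adj.
Proof. by move=> u; rewrite /gvertex_adj; case: (val u) => e x; rewrite gadj_irr. Qed.

Definition ggraph : sgraph := SGraph gvertex_adj_sym gvertex_adj_irr.

Hypothesis fibre2 :
  forall e, #|[set q : bool * E | s q.1 q.2 == Some e]| <= 2.

Lemma ggraph_max_degree : max_degree ggraph <= 3.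
Proof.
apply/bigmax_leqP => u _; rewrite /degree.
case ue: (val u) => [e x].
have [x13|x13] := eqVneq (x : nat) 13.
  set S := [set q : bool * E | s q.1 q.2 == Some e].
  pose r := (6, e) :: [seq ((if q.1 then 12 else 11), q.2) | q <- enum S].
  apply: (@leq_trans (size r)); last by rewrite /= size_map -cardE; apply: fibre2.
  apply: (@leq_card_seq _ _ _ (fun v : gvertex => ((val v).2 : nat, (val v).1))).
    move=> v w _ _ [vw2 vw1]; apply/val_inj.
    by rewrite [val v]surjective_pairing [val w]surjective_pairing vw1 (val_inj vw2).
  move=> v; rewrite inE /= /gvertex_adj ue x13 eqxx.
  rewrite -[sval v]/(val v); case: (val v) => e' y /= /andP[].
  rewrite /gadj /= !inE => /or3P[]/eqP->; rewrite /port_target /= => vs.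
  - by case/eqP: vs => ->; rewrite eqxx.
  - apply/mapP; exists (false, e') => //.
    by rewrite mem_enum inE.
  - apply/mapP; exists (true, e') => //.
    by rewrite mem_enum inE.
apply: (@leq_trans (size (nth [::] gadget_nbrs x))); last first.
  suff /allP/(_ _ (mem_nth [::] (ltn_ord x : x < size gadget_nbrs))) :
    all (fun r => size r <= 3) gadget_nbrs by [].
  by [].
(* A non-hub vertex has at most one neighbour over each vertex of H. *)
apply: (@leq_card_seq _ _ _ (fun v : gvertex => (val v).2 : nat)).
  move=> v w; rewrite !inE /= /gvertex_adj ue (negPf x13).
  move=> + + vw2; case vE: (val v) => [a y]; case wE: (val w) => [b z].
  move: vw2; rewrite vE wE /= => yz; rewrite yz => /andP[_ av] /andP[_ bw].
  apply/val_inj; rewrite vE wE (val_inj yz); congr pair.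
  move: av bw; case: ifP => _; last by move=> /eqP<- /eqP<-.
  by move=> /eqP -> /eqP[].
move=> v; rewrite inE /= /gvertex_adj ue -[sval v]/(val v).
by case: (val v) => e' y /andP[].
Qed.

Definition commuting (F : E -> E) : Prop :=
  forall b e e', s b e = Some e' -> s b (F e) = Some (F e').

Section Lift.

Variables (F : E -> E) (Fs : commuting F).

Fact lift_vertex_subproof (u : gvertex) :
  ((val u).2 != 13 :> nat) || target (F (val u).1).
Proof.
case/orP: (valP u) => [->//|/existsP[[b e] /= /eqP/Fs Fe]].
by apply/orP; right; apply/existsP; exists (b, F e); rewrite Fe.
Qed.

Definition lift_vertex (u : gvertex) : gvertex :=
  Sub (F (val u).1, (val u).2) (lift_vertex_subproof u).

Fact lift_endo_subproof : @is_endo ggraph [ffun u => lift_vertex u].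
Proof.
apply/forallP => u; apply/forallP => v; apply/implyP; rewrite !ffunE /= /gvertex_adj /=.
case: (val u) (val v) => e x [e' y] /= /andP[-> /=].
have port z a a' : port_target z a == Some a' -> port_target z (F a) == Some (F a').
  by rewrite /port_target; case: ifP => [_ /eqP[->]//|_ /eqP/Fs->].
by case: ifP => _; [|case: ifP => _]; [apply: port|apply: port|move/eqP->].
Qed.

Definition lift_endo : End ggraph := MkEnd lift_endo_subproof.

End Lift.

Fact core_subproof (e : E) (i : 'I_13) :
  let u := (e, widen_ord (leqnSn 13) i) in (u.2 != 13 :> nat) || target u.1.
Proof. by rewrite /= neq_ltn ltn_ord. Qed.

Definition core (e : E) (i : 'I_13) : gvertex := Sub (e, _) (core_subproof e i).

(** * Endomorphisms of the gadget graph *)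

Section Rigidity.

Variable f : End ggraph.

Let fadj (u v : gvertex) : gvertex_adj u v -> gvertex_adj (f u) (f v).
Proof. by move: (endoP f) => /forallP/(_ u)/forallP/(_ v)/implyP. Qed.

Definition core_image (e : E) : E := (val (f (core e ord0))).1.

Lemma endo_core e i : val (f (core e i)) = (core_image e, widen_ord (leqnSn 13) i).
Proof.
have fgadj (j k : 'I_13) : gadj j k -> gvertex_adj (f (core e j)) (f (core e k)).
  move=> jk; apply: fadj; rewrite /gvertex_adj /= jk.
  by rewrite !(ltn_eqF (ltn_ord _)) eqxx.
(* Projecting the image of a copy of K to H gives a homomorphism K -> H, so rigidity applies. *)
have f2 (j : 'I_13) : (val (f (core e j))).2 = j :> nat.
  rewrite -[RHS](@gadget_rigid (fun k => (val (f (core e (inord k)))).2)) //.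
  - by rewrite inord_val.
  - move=> k l k13 l13 kl; have := @fgadj (inord k) (inord l).
    rewrite !inordK // => /(_ kl); rewrite /gvertex_adj.
    by case: (val (f _)) (val (f _)) => a x [b y] /= /andP[].
(* Edges between non-hub vertices stay inside one copy, and K is connected. *)
have f1 k : k < 13 -> (val (f (core e (inord k)))).1 = core_image e.
  elim/ltn_ind: k => -[_ _|k IHk k13].
    by congr (val (f (core e _))).1; apply/val_inj; rewrite /= inordK.
  have [j jk kj] := @gadget_back_neighbour k.+1 k13.
  have j13 := ltn_trans jk k13.
  rewrite -(IHk j jk j13); have := @fgadj (inord k.+1) (inord j).
  rewrite !inordK // => /(_ kj); rewrite /gvertex_adj.
  have := f2 (inord k.+1); have := f2 (inord j).
  case: (val (f _)) (val (f _)) => a x [b y] /= -> ->.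
  by rewrite !inordK // !ltn_eqF // => /andP[_ /eqP].
rewrite [LHS]surjective_pairing -{1}(inord_val i) f1 //.
by congr pair; apply/val_inj; rewrite /= f2.
Qed.

Lemma endo_hub (u : gvertex) b e e' : s b e' = Some e -> val u = (e, ord_max) ->
  val (f u) = (core_image e, ord_max) /\ s b (core_image e') = Some (core_image e).
Proof.
move=> se' ue.
have u6 : gvertex_adj u (core e (@Ordinal 13 6 isT)).
  by rewrite /gvertex_adj ue /= /port_target eqxx.
pose p : 'I_13 := if b then @Ordinal 13 12 isT else @Ordinal 13 11 isT.
have up : gvertex_adj u (core e' p).
  by rewrite /gvertex_adj ue /= /p; case: b se' {p} => /= <-; rewrite /port_target.
move: (fadj u6) (fadj up); rewrite /gvertex_adj !endo_core.
case: (val (f u)) => a x /= /andP[x6 a6] /andP[xp ap].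
have x13 : x = 13 :> nat.
  apply: (@gadget_ports_common _ b); first by rewrite gadj_sym.
  by rewrite gadj_sym; move: xp; rewrite /p; case: (b).
move: a6 ap; rewrite x13 eqxx => /eqP[<-] /eqP.
have -> : x = ord_max by apply/val_inj.
by rewrite /p; case: (b).
Qed.

Lemma core_image_commuting : commuting core_image.
Proof.
move=> b e' e se'.
have ue : ((e, ord_max : 'I_14).2 != 13 :> nat) || target (e, ord_max : 'I_14).1.
  by apply/existsP; exists (b, e'); rewrite se'.
by have [] := @endo_hub (Sub (e, ord_max) ue) _ _ _ se' erefl.
Qed.

Lemma lift_endo_core_image : f = lift_endo core_image_commuting.
Proof.
apply/val_inj/ffunP => u; apply/val_inj; rewrite /= ffunE /=.
case: (boolP ((val u).2 != 13 :> nat)) (valP u) => /= [u13 _|].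
  have u2 : (val u).2 < 13 by rewrite ltn_neqAle u13 -ltnS ltn_ord.
  have {1}-> : u = core (val u).1 (Ordinal u2).
    by apply/val_inj; rewrite [LHS]surjective_pairing; congr pair; apply/val_inj.
  by rewrite endo_core; congr pair; apply/val_inj.
rewrite negbK => /eqP u13 /existsP[[b e'] /= /eqP se'].
have ue : val u = ((val u).1, ord_max).
  by rewrite [LHS]surjective_pairing; congr pair; apply/val_inj.
by have [-> _] := endo_hub se' ue; rewrite ue.
Qed.

End Rigidity.

End GadgetReplacement.

(** * The partial algebra of a lattice *)

Section LatticeAlgebra.

Variables (d : Order.disp_t) (L : finTBLatticeType d).
Local Notation N := #|{: L}|.

(* The first summand makes rank monotone, the second makes it injective. *)
Definition rank (w : L) : nat := #|[set v : L | (v <= w)%O]| * N + enum_rank w.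

(** Every rank is below [height.-1], so the last step of a chain identifies nothing; this leaves
    room for the loop in the fibre of the final [\bot]. *)
Definition height : nat := (N.+1 * N).+1.

Lemma rank_lt w : rank w < height.-1.
Proof.
rewrite /rank /height /= mulSn addnC -addSn leq_add ?ltn_ord //.
by rewrite leq_mul2r max_card orbT.
Qed.

Lemma rank_inj : injective rank.
Proof.
move=> v w /(congr1 (modn^~ N)); rewrite /rank !modnMDl !modn_small ?ltn_ord //.
by move=> /val_inj/enum_rank_inj.
Qed.

Lemma rank_homo v w : (v <= w)%O -> rank v <= rank w.
Proof.
rewrite le_eqVlt => /predU1P[->//|vw].
apply: (@leq_trans (#|[set u : L | (u <= v)%O]|.+1 * N)).
  by rewrite mulSn addnC leq_add2l ltnW ?ltn_ord.
rewrite (leq_trans _ (leq_addr _ _)) // leq_mul2r; apply/orP; right.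
apply/proper_card/properP; split.
  by apply/subsetP => u; rewrite !inE => /le_trans; apply; apply: ltW.
by exists w; rewrite !inE ?lexx // lt_geF.
Qed.

Definition collapse (p : L) (i : nat) (w : L) : L :=
  if rank w < i then if (p <= w)%O then p else \bot%O else w.

Lemma collapse0 p w : collapse p 0 w = w.
Proof. by []. Qed.

Lemma collapse_bot p i : collapse p i \bot%O = \bot%O.
Proof. by rewrite /collapse lex0; case: ifP => // _; case: eqP. Qed.

Lemma collapse_gen p i : collapse p i p = p.
Proof. by rewrite /collapse lexx if_same. Qed.

Lemma collapse_collapse p i k w : k <= i ->
  collapse p i (collapse p k w) = collapse p i w.
Proof.
move=> ki; rewrite {2}/collapse; case: (ltnP (rank w) k) => // wk.
rewrite [RHS]/collapse (leq_trans wk ki).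
by case: ifP => _; rewrite ?collapse_gen ?collapse_bot.
Qed.

(** Monotonicity of [rank] makes [x /\ w] collapse whenever [w] does; and if [p <= w], then [x /\ w]
    and [x /\ p] lie above [p] under the same condition [p <= x]. *)
Lemma collapse_meet p i x w :
  collapse p i (x `&` collapse p i w)%O = collapse p i (x `&` w)%O.
Proof.
rewrite {2}/collapse; case: (ltnP (rank w) i) => // wi.
have xwi : rank (x `&` w)%O < i by apply: leq_ltn_trans (rank_homo (leIr _ _)) wi.
case: ifP => pw; last by rewrite meetx0 collapse_bot /collapse xwi lexI pw andbF.
rewrite /collapse xwi !lexI pw lexx andbT.
by rewrite (leq_ltn_trans (rank_homo (leIr _ _)) (leq_ltn_trans (rank_homo pw) wi)).
Qed.

Lemma collapse_height p w : collapse p height w = if (p <= w)%O then p else \bot%O.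
Proof. by rewrite /collapse (ltn_trans (rank_lt w)). Qed.

(** The extra column [N] falls on the default [\bot]. *)
Definition gen (j : nat) : L := nth \bot%O (enum {: L}) j.

(* (j, i, w): the point w of the i-th quotient in the chain of p = gen j, each
   class being represented by its fixed point under collapse p i. *)
Definition elt : finType :=
  {u : 'I_N.+1 * 'I_height.+1 * L | collapse (gen u.1.1) u.1.2 u.2 == u.2}.

Definition col (e : elt) : 'I_N.+1 := (val e).1.1.
Definition row (e : elt) : 'I_height.+1 := (val e).1.2.
Definition pt (e : elt) : L := (val e).2.

Lemma eltP e : collapse (gen (col e)) (row e) (pt e) = pt e.
Proof. exact/eqP/(valP e). Qed.

Lemma elt_inj e e' :
  col e = col e' :> nat -> row e = row e' :> nat -> pt e = pt e' -> e = e'.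
Proof.
move=> /val_inj + /val_inj; rewrite /col /row /pt => c r p; apply/val_inj.
by move: c r p; case: (val e) (val e') => [[a b] c] [[a' b'] c'] /= -> -> ->.
Qed.

Fact mk_subproof (j : 'I_N.+1) (i : 'I_height.+1) (w : L) :
  let u := (j, i, collapse (gen j) i w) in collapse (gen u.1.1) u.1.2 u.2 == u.2.
Proof. by rewrite /= collapse_collapse. Qed.

Definition mk j i w : elt := Sub (j, i, _) (mk_subproof j i w).

Lemma mk_elt e : mk (col e) (row e) (pt e) = e.
Proof. by apply: elt_inj => //; apply: eltP. Qed.

(* The loops (third branch) mark the class of \bot at the end of each chain. *)
Definition step (b : bool) (e : elt) : option elt :=
  if b then
    if row e < height then Some (mk (col e) (inord (row e).+1) (pt e)) else None
  else if row e == 0 :> nat then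
    if col e < N then Some (mk (inord (col e).+1) (row e) (pt e)) else None
  else if (row e == height :> nat) && (pt e == \bot%O) then Some e else None.

Lemma step_trueP e' e : step true e' = Some e ->
  [/\ col e = col e', row e = (row e').+1 :> nat
    & pt e = collapse (gen (col e')) (row e').+1 (pt e')].
Proof.
rewrite /step; case: ifP => // rh [<-].
by split=> //; rewrite /row /pt /= inordK.
Qed.

Lemma step_falseP e' e : step false e' = Some e ->
  [/\ row e' = 0 :> nat, row e = 0 :> nat, col e = (col e').+1 :> nat & pt e = pt e']
  \/ [/\ row e' = height :> nat, pt e' = \bot%O & e = e'].
Proof.
rewrite /step; have [r0|_] := eqVneq (row e' : nat) 0.
  case: ifP => // cN [<-]; left; split=> //; first by rewrite /col /= inordK.
  by rewrite /pt /= r0 collapse0.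
by case: andP => // -[/eqP r /eqP p] [<-]; right.
Qed.

(** Injectivity of [rank] lets each [step true] merge at most one new element. Under [step false],
    shifts only reach row 0, which [step true] never enters, and loops only row [height], into which
    [step true] is injective. *)
Lemma step_fibre e : #|[set q : bool * elt | step q.1 q.2 == Some e]| <= 2.
Proof.
pose r := if row e == 0 :> nat then [:: (false, true)]
          else if row e == height :> nat then [:: (true, true); (false, true)]
          else [:: (true, true); (true, false)].
apply: (@leq_trans (size r)); last by rewrite /r; do 2?case: ifP.
have rank_new e' : step true e' = Some e -> pt e' != pt e -> rank (pt e') = row e'.
  move=> /step_trueP[_ _ ->] ne; apply/eqP; rewrite eqn_leq.
  have := eltP e'; rewrite {1}/collapse; case: ifP => [_ pe'|/negbT].
    move: ne; rewrite -pe'; case: ifP => _;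
    by rewrite ?collapse_gen ?collapse_bot eqxx.
  rewrite -leqNgt => -> _; rewrite andbT leqNgt; apply/negP => lt.
  by move: ne; rewrite /collapse ltnS ltn_geF // eqxx.
apply: (@leq_card_seq _ _ _ (fun q : bool * elt => (q.1, pt q.2 == pt e))).
  move=> [b e1] [b' e2]; rewrite !inE /= => /eqP s1 /eqP + [bb].
  rewrite -{b'}bb => s2 pp; congr pair.
  case: b s1 s2 => [s1 s2|/step_falseP s1 /step_falseP s2].
    have [c1 r1 _] := step_trueP s1; have [c2 r2 _] := step_trueP s2.
    have r12 : row e1 = row e2 :> nat by move: r1; rewrite r2 => -[].
    apply: elt_inj => //; first by rewrite -c1 -c2.
    have [p1|p1] := eqVneq (pt e1) (pt e).
      by move: pp; rewrite p1 eqxx => /esym/eqP->.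
    apply: rank_inj; rewrite (rank_new e1) // (rank_new e2) //.
    by rewrite -pp.
  case: s1 s2 => [[r1 r1e c1 p1]|[r1 p1 e1e]] [[r2 r2e c2 p2]|[r2 p2 e2e]].
  - apply: elt_inj; [by move: c1; rewrite c2 => -[]|by rewrite r1 r2|].
    by rewrite -p1 -p2.
  - by move: r2; rewrite -e2e r1e.
  - by move: r1; rewrite -e1e r2e.
  - by rewrite -e1e -e2e.
move=> [b e']; rewrite inE /= /r => /eqP; case: b => [se'|/step_falseP].
  have [_ re _] := step_trueP se'; rewrite re /=.
  case: ifP => [/eqP rh|_]; last by case: eqP.
  have [//|ne] := eqVneq (pt e') (pt e).
  have := rank_lt (pt e'); rewrite (rank_new _ se' ne).
  by move: rh => [->]; rewrite ltnn.
case=> [[_ -> _ ->]|[rh _ ->]]; first by rewrite !eqxx.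
by rewrite rh !eqxx.
Qed.

Definition act (x : L) (e : elt) : elt := mk (col e) (row e) (x `&` pt e)%O.

Lemma act_commuting x : commuting step (act x).
Proof.
case=> e e'; rewrite /step /=.
  case: ifP => // rh [<-]; rewrite /act; congr Some; apply: elt_inj => //.
  rewrite /pt /= inordK // collapse_meet collapse_collapse //.
case: ifP => [/eqP r0|r0].
  case: ifP => // cN [<-]; rewrite /act; congr Some; apply: elt_inj => //.
  by rewrite /pt /= r0.
case: andP => // -[rh /eqP p0] [<-].
by rewrite /act /pt /= -/(pt e) p0 meetx0 collapse_bot rh eqxx.
Qed.

Lemma act_mk x j i w : act x (mk j i w) = mk j i (x `&` w)%O.
Proof. by apply: elt_inj => //; rewrite /pt /= collapse_meet. Qed.

Lemma act_act x y e : act x (act y e) = act (x `&` y)%O e.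
Proof. by rewrite {2}/act act_mk meetA. Qed.

Lemma act_top e : act \top%O e = e.
Proof. by rewrite /act meet1x mk_elt. Qed.

Definition base (j : nat) (w : L) : elt := mk (inord j) ord0 w.

(** * Maps commuting with the operations *)

Section CommutingMaps.

Variables (F : elt -> elt) (Fs : commuting step F).

Lemma commuting_base_step j w : j < N ->
  [/\ row (F (base j w)) = 0 :> nat, row (F (base j.+1 w)) = 0 :> nat,
      col (F (base j.+1 w)) = (col (F (base j w))).+1 :> nat
    & pt (F (base j.+1 w)) = pt (F (base j w))].
Proof.
move=> jN; have jE : col (base j w) = j :> nat by rewrite /col /= inordK // ltnW.
have : step false (base j w) = Some (base j.+1 w).
  by rewrite /step jE jN; congr Some; apply: elt_inj.
move=> /Fs/step_falseP[//|[rh _ _]].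
(* The loop case puts the image in row [height], where [step true] is undefined although it is
   defined at [base j w]. *)
have : step true (base j w) = Some (mk (inord j) (inord 1) w) by [].
by move=> /Fs; rewrite /step rh ltnn.
Qed.

Definition base_image (w : L) : L := pt (F (base 0 w)).

Lemma commuting_base j w : j <= N -> F (base j w) = base j (base_image w).
Proof.
have N0 : 0 < N by apply/card_gt0P; exists \bot%O.
have shift k : k <= N -> [/\ row (F (base k w)) = 0 :> nat,
    col (F (base k w)) = col (F (base 0 w)) + k :> nat
  & pt (F (base k w)) = base_image w].
  elim: k => [_|k IHk kN].
    by have [r _ _ _] := commuting_base_step w N0; rewrite addn0.
  have [_ r -> ->] := commuting_base_step w kN.
  by have [_ -> ->] := IHk (ltnW kN); rewrite addnS.
(* [N] successive shifts fit into [N + 1] columns only from column 0. *)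
have c0 : col (F (base 0 w)) = 0 :> nat.
  have [_ cN _] := shift N (leqnn _); have := ltn_ord (col (F (base N w))).
  by rewrite cN ltnS -[leqRHS]add0n leq_add2r leqn0 => /eqP.
move=> jN; have [r c p] := shift j jN; apply: elt_inj => //.
by rewrite c c0 /col /= inordK.
Qed.

Lemma commuting_mk j i w : F (mk j i w) = mk j i (base_image w).
Proof.
rewrite -(inord_val j) -(inord_val i); have := ltn_ord i.
elim: (i : nat) => [_|k IHk kh].
  have -> : inord 0 = ord0 :> 'I_height.+1 by apply/val_inj; rewrite /= inordK.
  by apply: commuting_base; rewrite -ltnS ltn_ord.
have step_mk v : step true (mk (inord j) (inord k) v) =
    Some (mk (inord j) (inord k.+1) v).
  have rk : row (mk (inord j) (inord k) v) = k :> nat by rewrite /row /= inordK // ltnW.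
  rewrite /step rk -ltnS kh; congr Some; apply: elt_inj => //.
  by rewrite /pt /= !inordK ?collapse_collapse // ltnW.
by have /Fs := step_mk w; rewrite IHk 1?ltnW // step_mk => -[].
Qed.

Lemma base_image_meet w : base_image w = (base_image \top `&` w)%O.
Proof.
suff le_image p : (p <= base_image w)%O = (p <= base_image \top `&` w)%O.
  by apply/le_anti; rewrite le_image lexx -le_image lexx.
have pL : p \in enum {: L} by rewrite mem_enum.
have [p0|p0] := eqVneq p \bot%O; first by rewrite p0 !le0x.
have jN : index p (enum {: L}) < N.+1 by rewrite ltnS cardE index_size.
pose e v := mk (Ordinal jN) ord_max v.
have pt_e v : pt (e v) = if (p <= v)%O then p else \bot%O.
  by rewrite /pt /= /gen nth_index // collapse_height.
have Fe v : F (e v) = e (base_image v) by apply: commuting_mk.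
rewrite lexI; have [pw|pw] := boolP (p <= w)%O.
  (* Here [e w] and [e \top] are the same element, hence so are their images. *)
  have : pt (F (e w)) = pt (F (e \top%O)).
    by congr (pt (F _)); apply: elt_inj => //; rewrite !pt_e pw lex1.
  rewrite !Fe !pt_e andbT; case: ifP => _; case: ifP => _ //.
    by move/eqP; rewrite (negPf p0).
  by move/esym/eqP; rewrite (negPf p0).
(* Now [e w] carries a loop, so its image must be a looped [\bot] too. *)
have : step false (e w) = Some (e w) by rewrite /step pt_e (negPf pw) /= !eqxx.
move=> /Fs/step_falseP[[]|[_ + _]]; first by rewrite Fe.
by rewrite Fe pt_e andbF; case: ifP => // _ /eqP; rewrite (negPf p0).
Qed.

Lemma commuting_act e : F e = act (base_image \top%O) e.
Proof. by rewrite -(mk_elt e) commuting_mk act_mk base_image_meet. Qed.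

End CommutingMaps.

End LatticeAlgebra.

(* finTBLatticeType is the type of nonempty finite lattices. *)
Theorem theorem2 (d : Order.disp_t) (L : finTBLatticeType d) :
  exists G : sgraph,
    max_degree G <= 3 /\ monoid_isomorphic (End G) (meet_monoid L).
Proof.
exists (ggraph (@step d L)); split; first exact/ggraph_max_degree/step_fibre.
pose lift x := lift_endo (@act_commuting d L x).
pose param (f : End (ggraph (@step d L))) : meet_monoid L :=
  base_image (core_image f) \top%O.
have liftK : cancel lift param.
  move=> x; rewrite /param /base_image /core_image /= ffunE /= act_mk.
  by rewrite /pt /= collapse0 meetx1.
have paramK : cancel param lift.
  move=> f; rewrite [RHS]lift_endo_core_image; apply/val_inj/ffunP => u.
  rewrite !ffunE; apply/val_inj => /=; congr pair.
  by rewrite -(commuting_act (core_image_commuting f)).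
have liftM x y : lift (x `&` y)%O = endo_comp (lift x) (lift y).
  apply/val_inj/ffunP => u; rewrite !ffunE; apply/val_inj => /=.
  by rewrite ?ffunE /= act_act.
have lift1 : lift \top%O = endo_id _.
  apply/val_inj/ffunP => u; rewrite !ffunE; apply/val_inj => /=.
  by rewrite act_top -surjective_pairing.
exists param; last by exists lift.
split=> [|f g]; first by rewrite -[LHS]/(param (endo_id _)) -lift1 liftK.
(* [param] inherits multiplicativity from its inverse [lift]. *)
rewrite -[in LHS](paramK f) -[in LHS](paramK g).
by rewrite -[LHS]/(param (endo_comp _ _)) -liftM liftK.
Qed.
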